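(* Let $1<p<N$ and let $F\in C^0([0,\infty))$ be any strictly convex function with $\lim_{s\to\infty}F(s)=\infty$. Then there exists a nonnegative increasing function $\beta\in C^0([0,\infty))$ with $\lim_{t\to\infty}\beta(t)=\infty$ such that the function $g$ corresponding to $\beta$ satisfies $$\limsup_{\tau\to\infty}\frac{g(\tau)}{F(\tau)}=\infty .$$
   Context: For a nonnegative $\beta\in C^0([0,\infty))$, set $\gamma(t)=\int_0^t\beta(\theta)\,d\theta$ and $\Psi(t)=\int_0^te^{\gamma(\theta)/(p-1)}\,d\theta$ for $t\ge0$; $\Psi$ is an increasing bijection of $[0,\infty)$ onto $[0,\infty)$. The function $g:[0,\infty)\to[0,\infty)$ corresponding to $\beta$ is defined by $g(\Psi(t))=e^{\gamma(t)/(p-1)}-1$ for all $t\ge0$. *)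

(* Defs.v *)
From HB Require Import structures.
From mathcomp Require Export all_boot all_order all_algebra.
From mathcomp Require Export all_classical all_reals all_analysis.

Set Implicit Arguments.
Unset Strict Implicit.
Unset Printing Implicit Defensive.

Import Order.TTheory GRing.Theory Num.Theory.
Import numFieldNormedType.Exports.

Local Open Scope classical_set_scope.
Local Open Scope ring_scope.

(* A function on [0, +oo[ is encoded as a total function R -> R of which only
   the values at nonnegative arguments are constrained. *)

Definition gamma (R : realType) (beta : R -> R) (t : R) : R :=
  \int[lebesgue_measure]_(theta in `[0, t]) beta theta.

Definition Psi (R : realType) (p : R) (beta : R -> R) (t : R) : R :=
  \int[lebesgue_measure]_(theta in `[0, t]) expR (gamma beta theta / (p - 1)).

(* Psi p beta maps [0, +oo[ bijectively onto itself when 1 < p and beta is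
   continuous and nonnegative, so the equation determines g on [0, +oo[. *)
Definition corresponding (R : realType) (p : R) (beta g : R -> R) : Prop :=
  (forall s, 0 <= s -> 0 <= g s) /\
  (forall t, 0 <= t -> g (Psi p beta t) = expR (gamma beta t / (p - 1)) - 1).

Definition strictly_convex_on (R : realType) (D : set R) (f : R -> R) : Prop :=
  forall x y t : R, D x -> D y -> x != y -> 0 < t -> t < 1 ->
    f (t * x + (1 - t) * y) < t * f x + (1 - t) * f y.

(* Main.v *)
Require Import Defs.
From mathcomp Require Import lra.
(** With h(Psi t) = Psi' t = e^(gamma t/(p-1)) we have g = h - 1 and
    h' (Psi t) = beta t/(p-1), so g may exceed any prescribed value shortly after
    any given point: it suffices that beta rises steeply enough.  We take
    beta t = t + sum_n c_n max(0, t - n), where c_n depends on c_0, ..., c_(n-1)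
    and makes e^(gamma/(p-1)) reach K_n at time n + 1/K_n.  Since Psi grows by at
    most 1 in the meantime, K_n can be taken larger than n times the maximum of F
    on [0, Psi n + 1]. *)

Set Implicit Arguments.
Unset Strict Implicit.
Unset Printing Implicit Defensive.

Import Order.TTheory GRing.Theory Num.Theory.
Import numFieldNormedType.Exports.
Local Open Scope classical_set_scope.
Local Open Scope ring_scope.

(** * Integrals over compact segments: splitting and constant bounds *)

Section SegmentIntegrals.
Context {R : realType}.
Local Notation mu := (@lebesgue_measure R).
Implicit Types (f : R -> R) (a b c m : R).

Lemma integrable_segmentS f a b c d : c <= a -> b <= d ->
  mu.-integrable `[c, d] (EFin \o f) -> mu.-integrable `[a, b] (EFin \o f).
Proof.
move=> ca bd; apply: integrableS => //.
by apply: subset_itv; rewrite leBSide.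
Qed.

Lemma continuous_integrable_segment f a b :
  continuous f -> mu.-integrable `[a, b] (EFin \o f).
Proof.
move=> cf; apply: continuous_compact_integrable; first exact: segment_compact.
exact: continuous_subspaceT.
Qed.

Lemma Rintegral_segment_split f a b c : a <= b -> b <= c ->
  mu.-integrable `[a, c] (EFin \o f) ->
  \int[mu]_(x in `[a, c]) f x =
  \int[mu]_(x in `[a, b]) f x + \int[mu]_(x in `[b, c]) f x.
Proof.
move=> ab bc intf.
have := @Rintegral_itvB R f (BLeft a) (BRight c) b intf.
rewrite !bnd_simp => /(_ ab bc) /eqP; rewrite subr_eq addrC => /eqP ->.
(* The difference of integrals lives on the half-open interval from [b] to [c]; adding the endpoint
   [b] changes nothing. *)
rewrite Rintegral_itv_obnd_cbnd//.
apply: integrableS intf => //.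
by apply: subset_itv; rewrite bnd_simp.
Qed.

Lemma Rintegral_segment_cst m a b : a <= b ->
  \int[mu]_(x in `[a, b]) m = m * (b - a).
Proof.
move=> ab; rewrite Rintegral_cst//= lebesgue_measure_itv/= lte_fin.
by move: ab; rewrite le_eqVlt => /predU1P[->|->]; rewrite ?ltxx ?subrr//.
Qed.

Lemma Rintegral_segment_ge f a b m : a <= b ->
  mu.-integrable `[a, b] (EFin \o f) ->
  (forall x, a <= x <= b -> m <= f x) ->
  m * (b - a) <= \int[mu]_(x in `[a, b]) f x.
Proof.
move=> ab intf mf; rewrite -Rintegral_segment_cst//; apply: le_Rintegral => //.
by apply: continuous_integrable_segment => x; exact: cvg_cst.
Qed.

Lemma Rintegral_segment_le f a b m : a <= b ->
  mu.-integrable `[a, b] (EFin \o f) ->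
  (forall x, a <= x <= b -> f x <= m) ->
  \int[mu]_(x in `[a, b]) f x <= m * (b - a).
Proof.
move=> ab intf mf; rewrite -Rintegral_segment_cst//; apply: le_Rintegral => //.
by apply: continuous_integrable_segment => x; exact: cvg_cst.
Qed.

End SegmentIntegrals.

(** * Monotonicity and growth of [gamma] and [Psi], and existence of [g] *)

Section GammaPsi.
Context {R : realType}.
Local Notation mu := (@lebesgue_measure R).
Implicit Types (b h : R -> R) (c p s t : R).

Lemma eq_gamma b b' t : (forall s, 0 <= s <= t -> b s = b' s) ->
  gamma b t = gamma b' t.
Proof.
by move=> bb'; apply: eq_Rintegral => x; rewrite inE/= in_itv => /bb'.
Qed.

(** This locality lets ramps that start later leave earlier estimates intact. *)
Lemma eq_Psi p b b' t : (forall s, 0 <= s <= t -> b s = b' s) ->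
  Psi p b t = Psi p b' t.
Proof.
move=> bb'; apply: eq_Rintegral => x; rewrite inE/= in_itv/= => /andP[x0 xt].
rewrite (@eq_gamma b b' x)// => s /andP[s0 sx].
by apply: bb'; rewrite s0 (le_trans sx).
Qed.

Lemma gammaD b c h t : continuous b -> continuous h ->
  gamma (fun x => b x + c * h x) t = gamma b t + c * gamma h t.
Proof.
move=> cb ch; rewrite /gamma RintegralD//; last 2 first.
- exact: continuous_integrable_segment.
- apply: continuous_integrable_segment => x.
  by apply: cvgM; [exact: cvg_cst|exact: ch].
- by rewrite RintegralZl//; exact: continuous_integrable_segment.
Qed.

Lemma gamma_ge0 b t : (forall s, 0 <= s -> 0 <= b s) -> 0 <= gamma b t.
Proof.
by move=> b0; apply: Rintegral_ge0 => x /=; rewrite in_itv/= => /andP[/b0].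
Qed.

Lemma expR_gamma_ge1 p b t : 1 < p -> (forall s, 0 <= s -> 0 <= b s) ->
  1 <= expR (gamma b t / (p - 1)).
Proof.
move=> p1 b0; rewrite -[leLHS]expR0 ler_expR divr_ge0 ?gamma_ge0//.
by rewrite subr_ge0 ltW.
Qed.

Lemma gamma_homo b s t : continuous b -> (forall x, 0 <= x -> 0 <= b x) ->
  0 <= s -> s <= t -> gamma b s <= gamma b t.
Proof.
move=> cb b0 s0 st; rewrite /gamma (@Rintegral_segment_split _ _ 0 s t)//.
  rewrite lerDl; apply: Rintegral_ge0 => x /=; rewrite in_itv/= => /andP[sx _].
  by apply: b0; exact: le_trans sx.
exact: continuous_integrable_segment.
Qed.

Lemma integrable_Psi p b t : continuous b ->
  mu.-integrable `[0, t] (EFin \o (fun x => expR (gamma b x / (p - 1)))).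
Proof.
move=> cb; have [t0|t0] := leP 0 t; last first.
  by rewrite set_itv_ge ?bnd_simp -?ltNge//; exact: integrable_set0.
apply: continuous_compact_integrable; first exact: segment_compact.
have cg : {within `[0, t], continuous (gamma b)}.
  exact/parameterized_integral_continuous/continuous_integrable_segment.
move=> x; apply: (@continuous_comp (subspace `[0, t]) R R
    (fun x => gamma b x / (p - 1)) expR).
  by apply: cvgM; [exact: cg|exact: cvg_cst].
exact: continuous_expR.
Qed.

Lemma Psi_split p b s t : continuous b -> 0 <= s -> s <= t ->
  Psi p b t = Psi p b s +
    \int[mu]_(x in `[s, t]) expR (gamma b x / (p - 1)).
Proof.
by move=> cb s0 st; apply: Rintegral_segment_split => //; exact: integrable_Psi.
Qed.

(** The integrand of [Psi] is at least 1 because [gamma] is nonnegative. This yields both the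
    injectivity of [Psi] and its divergence at infinity. *)
Lemma Psi_expands p b s t : 1 < p -> continuous b ->
  (forall x, 0 <= x -> 0 <= b x) -> 0 <= s -> s <= t ->
  t - s <= Psi p b t - Psi p b s.
Proof.
move=> p1 cb b0 s0 st; rewrite (Psi_split p cb s0 st) addrAC subrr add0r.
rewrite -[leLHS]mul1r; apply: Rintegral_segment_ge => //.
  exact: (integrable_segmentS s0 (lexx t) (integrable_Psi p t cb)).
by move=> x _; exact: expR_gamma_ge1.
Qed.

Lemma Psi0 p b : Psi p b 0 = 0.
Proof. by rewrite /Psi set_itv1 Rintegral_set1. Qed.

Lemma ge_Psi p b t : 1 < p -> continuous b ->
  (forall x, 0 <= x -> 0 <= b x) -> 0 <= t -> t <= Psi p b t.
Proof.
move=> p1 cb b0 t0; have := Psi_expands p1 cb b0 (lexx 0) t0.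
by rewrite Psi0 !subr0.
Qed.

Lemma Psi_inj p b : 1 < p -> continuous b -> (forall x, 0 <= x -> 0 <= b x) ->
  {in `[0, +oo[ &, injective (Psi p b)}.
Proof.
move=> p1 cb b0; suff H s t : 0 <= s -> s < t -> Psi p b s < Psi p b t.
  move=> s t; rewrite !in_itv/= !andbT => s0 t0 st.
  by case: (ltgtP s t) => // [/(H _ _ s0)|/(H _ _ t0)]; rewrite st ltxx.
move=> s0 st; rewrite -subr_gt0.
by rewrite (lt_le_trans _ (Psi_expands p1 cb b0 s0 (ltW st)))// subr_gt0.
Qed.

(** Injectivity of [Psi] makes the prescribed values consistent, so [g] can be chosen pointwise; a
    point that is no value of [Psi] on nonnegative arguments gets 0. *)
Lemma corresponding_exists p b : 1 < p -> continuous b ->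
  (forall x, 0 <= x -> 0 <= b x) -> exists g, corresponding p b g.
Proof.
move=> p1 cb b0.
have P s : exists y, 0 <= y /\
    forall t, 0 <= t -> Psi p b t = s -> y = expR (gamma b t / (p - 1)) - 1.
  have [[t [t0 ts]]|nex] := pselect (exists t, 0 <= t /\ Psi p b t = s).
    exists (expR (gamma b t / (p - 1)) - 1); split.
      by rewrite subr_ge0 expR_gamma_ge1.
    move=> t' t'0 t's.
    by rewrite (@Psi_inj p b p1 cb b0 t t') ?in_itv/= ?andbT// ts.
  by exists 0; split=> // t t0 ts; case: nex; exists t.
have [g gP] := choice P.
by exists g; split=> [s _|t t0]; [case: (gP s)|case: (gP (Psi p b t)) => _; exact].
Qed.

End GammaPsi.

(** * Construction of the function beta *)

Section Construction.
Context {R : realType}.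
Implicit Types (F b : R -> R) (a c p s t : R).

Definition ramp a t : R := Num.max 0 (t - a).

Lemma continuous_ramp a : continuous (ramp a).
Proof.
move=> x; apply: (@continuous_max _ _ (fun=> 0) (fun t => t - a)).
  exact: cvg_cst.
by apply: cvgB; [exact: cvg_id|exact: cvg_cst].
Qed.

Lemma ramp_ge0 a t : 0 <= ramp a t.
Proof. by rewrite /ramp le_max lexx. Qed.

Lemma ramp_eq0 a t : t <= a -> ramp a t = 0.
Proof. by move=> ta; apply/max_idPl; rewrite subr_le0. Qed.

Lemma le_ramp a : {homo ramp a : s t / s <= t}.
Proof. by move=> s t st; rewrite /ramp le_max2// lerB. Qed.

(** Beyond the midpoint [m] of [a] and [t] the ramp is at least [m - a]. Positivity allows division
    by this integral when the slope is chosen. *)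
Lemma gamma_ramp_gt0 a t : 0 <= a -> a < t -> 0 < gamma (ramp a) t.
Proof.
move=> a0 at_; pose m := (a + t) / 2.
have [am mt] : a < m /\ m < t by rewrite /m; split; lra.
rewrite /gamma (@Rintegral_segment_split _ _ 0 m t); first last.
- exact/continuous_integrable_segment/continuous_ramp.
- exact: ltW.
- by rewrite (le_trans a0)// ltW.
apply: ltr_wpDl; first by apply: Rintegral_ge0 => x _; exact: ramp_ge0.
apply: (@lt_le_trans _ _ ((m - a) * (t - m))).
  by rewrite mulr_gt0// subr_gt0.
apply: Rintegral_segment_ge; first exact: ltW.
  exact/continuous_integrable_segment/continuous_ramp.
by move=> x /andP[mx _]; rewrite /ramp le_max lerB// orbT.
Qed.

Lemma continuous_addr_ramp b c a : continuous b ->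
  continuous (fun x => b x + c * ramp a x).
Proof.
move=> cb x; apply: cvgD; first exact: cb.
by apply: cvgM; [exact: cvg_cst|exact: continuous_ramp].
Qed.

Lemma addr_ramp_ge0 b c a : 0 <= c -> (forall x, 0 <= x -> 0 <= b x) ->
  forall x, 0 <= x -> 0 <= b x + c * ramp a x.
Proof. by move=> c0 b0 x x0; rewrite addr_ge0 ?b0// mulr_ge0 ?ramp_ge0. Qed.

(** The bound [M] on [F] is fixed before the slope: adding the ramp leaves [Psi] unchanged up to
    [a], and from [a] to [s] it grows by at most 1 whatever [K] is. *)
Lemma steep_ramp p F b a : 1 < p -> {within `[0, +oo[, continuous F} ->
  continuous b -> (forall x, 0 <= x -> 0 <= b x) -> 0 <= a ->
  exists c, 0 <= c /\ exists s, a <= s <= a + 1 /\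
    let b' := fun x => b x + c * ramp a x in
    a * F (Psi p b' s) <= expR (gamma b' s / (p - 1)) - 1.
Proof.
move=> p1 cF cb b0 a0; have p10 : 0 < p - 1 by rewrite subr_gt0.
have Psia0 : 0 <= Psi p b a by rewrite (le_trans a0)// ge_Psi.
have [M M0 FM] : exists2 M, 0 <= M &
    forall y, 0 <= y <= Psi p b a + 1 -> F y <= M.
  have cF' : {within `[0, Psi p b a + 1], continuous F}.
    apply: continuous_subspaceW cF => y /=; rewrite !in_itv/= andbT.
    by case/andP.
  have [d _ Fd] := EVT_max (addr_ge0 Psia0 ler01) cF'.
  exists (Num.max 0 (F d)); first by rewrite le_max lexx.
  by move=> y y01; rewrite le_max Fd ?orbT// in_itv.
(* The term 1 gives [K^-1 <= 1], the term [a * M] is the value to be reached, and the exponential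
   forces the slope [c] to be nonnegative. *)
pose K := 1 + a * M + expR (gamma b (a + 1) / (p - 1)).
have aM0 : 0 <= a * M by rewrite mulr_ge0.
have K1 : 1 <= K by rewrite /K -addrA lerDl addr_ge0// expR_ge0.
have K0 : 0 < K by exact: lt_le_trans K1.
pose s := a + K^-1.
have as_ : a < s by rewrite ltrDl invr_gt0.
have sa1 : s <= a + 1 by rewrite lerD2l invf_le1.
have s0 : 0 <= s by exact: le_trans (ltW as_).
have G0 : 0 < gamma (ramp a) s by exact: gamma_ramp_gt0.
(* This solves [gamma b s + c * gamma (ramp a) s = (p - 1) * ln K], so that the exponential equals
   [K] exactly at [s]. *)
pose c := ((p - 1) * ln K - gamma b s) / gamma (ramp a) s.
have c0 : 0 <= c.
  apply: divr_ge0; last exact: ltW.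
  rewrite subr_ge0 mulrC -ler_pdivrMr// -ler_expR lnK ?posrE//.
  apply: (@le_trans _ _ (expR (gamma b (a + 1) / (p - 1)))).
    by rewrite ler_expR ler_pM2r ?invr_gt0// gamma_homo.
  by rewrite /K lerDr addr_ge0.
exists c; split=> //; exists s; split; first by rewrite (ltW as_).
move=> b'.
have cb' : continuous b' by exact: continuous_addr_ramp.
have b'0 x : 0 <= x -> 0 <= b' x by exact: addr_ramp_ge0.
have EK : expR (gamma b' s / (p - 1)) = K.
  rewrite gammaD//; last exact: continuous_ramp.
  rewrite /c divfK ?gt_eqF// addrC subrK mulrC mulKf ?gt_eqF//.
  by rewrite lnK ?posrE.
have Psis : Psi p b' s <= Psi p b a + 1.
  rewrite (Psi_split p cb' a0 (ltW as_)); apply: lerD.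
    rewrite (@eq_Psi _ p b' b a)// => x /andP[_ xa].
    by rewrite /b' ramp_eq0// mulr0 addr0.
  (* By monotonicity of [gamma] the integrand stays below its final value [K] on a segment of length
     [K^-1]. *)
  have Ksa : K * (s - a) = 1 by rewrite /s addrAC subrr add0r divff// gt_eqF.
  rewrite -[leRHS]Ksa; apply: Rintegral_segment_le; first exact: ltW.
    exact: (integrable_segmentS a0 (lexx s) (integrable_Psi p s cb')).
  move=> x /andP[ax xs]; rewrite -EK ler_expR ler_pM2r ?invr_gt0//.
  by apply: gamma_homo => //; exact: le_trans ax.
rewrite EK; apply: (@le_trans _ _ (a * M)).
  apply: ler_wpM2l => //; apply: FM; rewrite Psis andbT.
  exact: (le_trans s0 (ge_Psi p1 cb' b'0 s0)).
by rewrite lerBrDl lerDl expR_ge0.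
Qed.

(** The slope rule [c] receives the corner and the whole function built so far, since each slope
    depends on the earlier ones. Starting from the identity secures strict growth and divergence. *)
Fixpoint ramp_sums (c : R * (R -> R) -> R) n : R -> R :=
  if n is m.+1 then
    fun x => ramp_sums c m x + c (m%:R, ramp_sums c m) * ramp m%:R x
  else id.

Section RampSums.
Variable c : R * (R -> R) -> R.
Hypothesis c0 : forall ab, 0 <= c ab.
Local Notation B := (ramp_sums c).

Lemma continuous_ramp_sums n : continuous (B n).
Proof.
elim: n => [|n IHn] /=; last exact: continuous_addr_ramp.
by move=> x; exact: cvg_id.
Qed.

Lemma ramp_sums_ge_id n x : x <= B n x.
Proof.
elim: n => [|n IHn] //=.
by rewrite (le_trans IHn)// lerDl mulr_ge0 ?ramp_ge0.
Qed.

Lemma ramp_sums_lt n : {homo B n : s t / s < t}.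
Proof.
elim: n => [|n IHn] //= s t st.
by rewrite ltr_leD ?IHn// ler_wpM2l// le_ramp// ltW.
Qed.

Lemma ramp_sums_stable n m x : (n <= m)%N -> x <= n%:R -> B m x = B n x.
Proof.
move=> + xn; elim: m => [|m IHm]; first by rewrite leqn0 => /eqP ->.
rewrite leq_eqVlt => /predU1P[->//|]; rewrite ltnS => nm /=.
by rewrite IHm// ramp_eq0 ?mulr0 ?addr0// (le_trans xn)// ler_nat.
Qed.

(** The pointwise limit of the partial sums, read off at an index from which they are already
    stationary at [t]. *)
Definition ramp_limit t : R := B (Num.truncn t).+1 t.

Lemma ramp_limitE n t : t <= n%:R -> ramp_limit t = B n t.
Proof.
move=> tn; rewrite /ramp_limit; have tt := ltW (truncnS_gt t).
by case: (leqP n (Num.truncn t).+1) => [nt|/ltnW tn'];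
  [rewrite (ramp_sums_stable nt)|rewrite (ramp_sums_stable tn')].
Qed.

Lemma continuous_ramp_limit : continuous ramp_limit.
Proof.
move=> t; rewrite /continuous_at /ramp_limit.
apply: cvg_trans (@continuous_ramp_sums (Num.truncn t).+1 t).
(* Every [y] below [(Num.truncn t).+1], hence every [y] near [t], sees the same partial sum. *)
apply: near_eq_cvg; near=> y; apply/esym/ramp_limitE/ltW.
by near: y; apply: lt_nbhsl; exact: truncnS_gt.
Unshelve. all: by end_near. Qed.

Lemma ramp_limit_ge_id t : t <= ramp_limit t.
Proof. exact: ramp_sums_ge_id. Qed.

Lemma ramp_limit_lt : {homo ramp_limit : s t / s < t}.
Proof.
move=> s t st; have tt := ltW (truncnS_gt t).
rewrite (ramp_limitE tt) (ramp_limitE (le_trans (ltW st) tt)).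
exact: ramp_sums_lt.
Qed.

End RampSums.

(** Each neighbourhood of infinity contains a ray, on which [f] is unbounded above, so every
    supremum in the infimum is infinite. *)
Lemma limf_esup_pinfty (f : R -> R) :
  (forall A t, exists2 y, t < y & A <= f y) ->
  limf_esup (EFin \o f) +oo = +oo%E.
Proof.
move=> fA; rewrite limf_esupE; apply/ereal_inf_pinfty => _ [V [t [_ tV]] <-].
apply/eq_infty => A; have [y ty Ay] := fA A t.
apply: (@le_trans _ _ (f y)%:E); first by rewrite lee_fin.
by apply: ereal_sup_ubound; exists y => //; exact: tV.
Qed.

Lemma exists_fast_Psi p F : 1 < p -> {within `[0, +oo[, continuous F} ->
  exists b, [/\ continuous b, forall t, t <= b t, {homo b : s t / s < t} &
    forall n : nat, exists2 s, n%:R <= s &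
      n%:R * F (Psi p b s) <= expR (gamma b s / (p - 1)) - 1].
Proof.
move=> p1 cF.
have P (ab : R * (R -> R)) : exists c, 0 <= c /\
    (0 <= ab.1 -> continuous ab.2 -> (forall x, 0 <= x -> 0 <= ab.2 x) ->
     exists s, ab.1 <= s <= ab.1 + 1 /\
       let b' := fun x => ab.2 x + c * ramp ab.1 x in
       ab.1 * F (Psi p b' s) <= expR (gamma b' s / (p - 1)) - 1).
  (* Choice requires a slope for every pair; pairs violating the assumptions of [steep_ramp] get
     slope 0. *)
  have [[a0 [cb b0]]|nab] := pselect (0 <= ab.1 /\ continuous ab.2 /\
      forall x, 0 <= x -> 0 <= ab.2 x).
    by have [c [c0 ?]] := steep_ramp p1 cF cb b0 a0; exists c.
  by exists 0; split=> // a0 cb b0; case: nab.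
have [c cP] := choice P; have c0 ab : 0 <= c ab by case: (cP ab).
exists (ramp_limit c); split.
- exact: continuous_ramp_limit.
- exact: ramp_limit_ge_id.
- exact: ramp_limit_lt.
move=> n; have [|//||s [/= /andP[ns sn1]]] := (cP (n%:R, ramp_sums c n)).2.
- by rewrite ler0n.
- exact: continuous_ramp_sums.
- by move=> x x0; exact: le_trans (ramp_sums_ge_id c0 n x).
exists s => //.
(* As [s] is at most [n + 1], the ramps with corner at [n + 1] or later vanish on the segment from 0
   to [s]. *)
have E x : 0 <= x <= s -> ramp_limit c x = ramp_sums c n.+1 x.
  by move=> /andP[_ xs]; rewrite (@ramp_limitE c n.+1)// -natr1 (le_trans xs).
by rewrite (eq_Psi p E) (eq_gamma E).
Qed.

End Construction.

Theorem mainTheorem6 (R : realType) (N : nat) (p : R)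
    (p_gt1 : 1 < p) (p_ltN : p < N%:R)
    (F : R -> R)
    (F_cont : {within `[0, +oo[, continuous F})
    (F_conv : strictly_convex_on `[0, +oo[ F)
    (F_lim : F s @[s --> +oo] --> +oo) :
  exists beta : R -> R,
    [/\ {within `[0, +oo[, continuous beta},
        forall t, 0 <= t -> 0 <= beta t,
        forall s t, 0 <= s -> s < t -> beta s < beta t &
        beta t @[t --> +oo] --> +oo] /\
    (exists g : R -> R, corresponding p beta g) /\
    (forall g : R -> R, corresponding p beta g ->
       limf_esup (fun tau => (g tau / F tau)%:E) +oo = +oo%E).
Proof.
have [b [cb b_ge b_lt bF]] := exists_fast_Psi p_gt1 F_cont.
have b0 x : 0 <= x -> 0 <= b x by move=> x0; exact: le_trans (b_ge x).
exists b; split; [split=> //|split].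
- exact: continuous_subspaceT.
- by move=> s t _; exact: b_lt.
- by apply: ger_cvgy cvg_id; near=> t; exact: b_ge.
- exact: corresponding_exists.
move=> g [_ gE]; apply: (@limf_esup_pinfty R (fun tau => g tau / F tau)) => A t.
(* Past [T] the denominator [F] is positive, so the quotient can be compared by clearing it. *)
have [T [_ FT]] : \forall s \near +oo, 1 <= F s by move/cvgryPge : F_lim; exact.
pose n := (Num.truncn (Num.max A (Num.max t T))).+1.
have := truncnS_gt (Num.max A (Num.max t T)); rewrite -/n !gt_max.
move=> /and3P[An tn Tn]; have [s ns nF] := bF n.
have s0 : 0 <= s by exact: le_trans ns.
have nPsi : n%:R <= Psi p b s by rewrite (le_trans ns)// ge_Psi.
exists (Psi p b s); first exact: lt_le_trans nPsi.
have F0 : 0 < F (Psi p b s).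
  by rewrite (lt_le_trans ltr01)// FT// (lt_le_trans Tn).
(* With [A < n] and [F] positive, [A * F] is at most [n * F], which [nF] bounds by the value of
   [g]. *)
rewrite ler_pdivlMr// gE// (le_trans _ nF)// ler_wpM2r//; exact: ltW.
Unshelve. all: by end_near. Qed.
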